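(* Let $M\in\mathbb{R}^{n\times n}$ be an entrywise nonnegative matrix with $(i,i)\in\mathrm{supp}(M)$ for all $i=1,\ldots,n$ and such that $\mathrm{supp}(M)=\mathrm{supp}(M^T)$. Let $v\in\mathbb{R}^{n\times 1}$ be a strictly positive vector. Then there exists a scaled matrix $S=D_{M,\ell}\,M\,D_{M,r}$ with row sums $S\mathbf{1}_n=v$ and column sums $\mathbf{1}_n^TS=v^T$, where $D_{M,\ell}$ and $D_{M,r}$ are diagonal matrices with positive main diagonals. Moreover, $S$ is unique and is the limit of the Sinkhorn-Knopp-like algorithm applied to $M$ with prescribed row sums $r=v$ and column sums $c=v$. If, in addition, $M$ is fully indecomposable, then $D_{M,\ell}$ and $D_{M,r}$ are also unique up to a scalar multiple, and, if (in this situation) $M=M^T$, then there exists a unique diagonal matrix $D$ with positive diagonal entries such that $S=DMD$.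
   Context: $\mathbf{1}_n=[1,\ldots,1]^T\in\mathbb{R}^n$. The support of a matrix $A=[a_{ij}]$ is $\mathrm{supp}(A)=\{(i,j) : a_{ij}\neq 0\}$. A nonnegative $n\times n$ matrix $M$ is fully indecomposable if there do not exist permutation matrices $P_\ell,P_r$ such that $P_\ell M P_r=\begin{bmatrix} M_{11}&M_{12}\\ 0&M_{22}\end{bmatrix}$ with $M_{11}$ and $M_{22}$ square (nonempty) matrices. ''Unique up to a scalar multiple'' means that, given one solution $(D_{M,\ell},D_{M,r})$, the set of all solutions is $\{(D_{M,\ell}/t,\ tD_{M,r}) : t>0\}$. Sinkhorn-Knopp-like algorithm for a nonnegative matrix $M$ with prescribed positive row-sum vector $r$ and column-sum vector $c$: initialize $D_{M,\ell}=I$, $D_{M,r}=I$; then repeat alternately: (1) multiply each row $i$ of the current matrix $M$ (and of $D_{M,\ell}$) by $r_i/\sum_j m_{ij}$, so that the updated matrix has row sums $r$; (2) multiply each column $j$ of the current matrix $M$ (and of $D_{M,r}$) by $c_j/\sum_i m_{ij}$, so that the updated matrix has column sums $c$. The limit refers to the limit of the sequence of updated matrices $M$. *)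

(* Defs.v *)
From HB Require Import structures.
From mathcomp Require Import all_boot all_order all_algebra.
From mathcomp Require Import all_classical all_reals all_analysis.

Set Implicit Arguments.
Unset Strict Implicit.
Unset Printing Implicit Defensive.

Import Order.TTheory GRing.Theory Num.Theory.
Import numFieldNormedType.Exports.

Local Open Scope ring_scope.

Definition nonneg_mx (R : realType) (m n : nat) (A : 'M[R]_(m, n)) : Prop :=
  forall i j, 0 <= A i j.

Definition supp (R : realType) (m n : nat) (A : 'M[R]_(m, n)) :
    {set 'I_m * 'I_n} :=
  [set ij : 'I_m * 'I_n | A ij.1 ij.2 != 0]%SET.

Definition ones (R : realType) (n : nat) : 'cV[R]_n := const_mx 1.
Arguments ones {R} n.

Definition pos_diag_mx (R : realType) (n : nat) (D : 'M[R]_n) : Prop :=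
  is_diag_mx D /\ forall i, 0 < D i i.

(* The cast is forced by the block dimensions: [block_mx] has type
   ['M_(p + q)]. *)
Definition fully_indecomposable (R : realType) (n : nat) (A : 'M[R]_n) : Prop :=
  ~ exists (p q : nat) (E : (p + q)%N = n) (Pl Pr : 'M[R]_n)
      (A11 : 'M[R]_p) (A12 : 'M[R]_(p, q)) (A22 : 'M[R]_q),
      [/\ (0 < p)%N, (0 < q)%N, is_perm_mx Pl, is_perm_mx Pr &
          Pl *m A *m Pr = castmx (E, E) (block_mx A11 A12 0 A22)].

Definition scaled_by (R : realType) (n : nat) (A S Dl Dr : 'M[R]_n) : Prop :=
  [/\ pos_diag_mx Dl, pos_diag_mx Dr & S = Dl *m A *m Dr].

Definition scaled_with_sums (R : realType) (n : nat) (A : 'M[R]_n)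
    (r c : 'cV[R]_n) (S : 'M[R]_n) : Prop :=
  [/\ exists Dl Dr : 'M[R]_n, scaled_by A S Dl Dr,
      S *m ones n = r & (ones n)^T *m S = c^T].

Record sinkhorn_state (R : realType) (n : nat) : Type := SinkhornState {
  sk_left : 'M[R]_n;
  sk_mx : 'M[R]_n;
  sk_right : 'M[R]_n }.

Definition row_step (R : realType) (n : nat) (r : 'cV[R]_n)
    (s : sinkhorn_state R n) : sinkhorn_state R n :=
  let F := diag_mx (\row_i (r i 0 / \sum_j sk_mx s i j)) in
  SinkhornState (F *m sk_left s) (F *m sk_mx s) (sk_right s).

Definition col_step (R : realType) (n : nat) (c : 'cV[R]_n)
    (s : sinkhorn_state R n) : sinkhorn_state R n :=
  let F := diag_mx (\row_j (c j 0 / \sum_i sk_mx s i j)) in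
  SinkhornState (sk_left s) (sk_mx s *m F) (sk_right s *m F).

(* State after [k] half-steps, so that both the row-normalized and the
   column-normalized matrices occur in the sequence. *)
Fixpoint sinkhorn (R : realType) (n : nat) (A : 'M[R]_n) (r c : 'cV[R]_n)
    (k : nat) : sinkhorn_state R n :=
  if k is k'.+1 then
    if odd k' then col_step c (sinkhorn A r c k')
    else row_step r (sinkhorn A r c k')
  else SinkhornState 1%:M A 1%:M.

(* Main.v *)
Require Import Defs.
From HB Require Import structures.
From mathcomp Require Import all_boot all_order all_fingroup all_algebra.
From mathcomp Require Import all_classical all_reals all_analysis.
From mathcomp Require Import lra ring.

(** Call A a rescaling of M when A = D1 M D2 with D1, D2 positive diagonal.
    The theorem rests on three facts about rescalings.

    (1) Strict monotonicity of ln gives uniqueness. If A and B are rescalings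
    of M, then on the common support ln A(i,j) - ln B(i,j) = x(i) + y(j), so
    the sum of (A - B)(i,j) * (ln A - ln B)(i,j) equals the sum of x against
    the differences of row sums plus the sum of y against the differences of
    column sums ([sum_rescaling_log]). The left-hand side dominates the squared
    distance of A and B ([sum_sqr_rescaling_le]), so two rescalings with equal
    row and column sums coincide ([rescaling_unique]).

    (2) The same identity is quantitative. The potentials x, y can be chosen
    as fixed linear functions of ln A - ln B ([linear_potentials]), hence
    bounded if the logarithms are. A sequence of rescalings with bounded
    logarithms and converging row and column sums is therefore Cauchy, and its
    limit is again a rescaling of M ([rescalings_cvg]).

    (3) The iteration satisfies the hypotheses of (2) as soon as some
    nonnegative W has the support of M and the prescribed sums
    ([sinkhorn_cvg]). Indeed L(A) = sum of W(i,j) ln A(i,j) grows at each step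
    by a Kullback-Leibler divergence that dominates the squared error of the
    sums being corrected ([normalize_rows_gain]). Since L is bounded above the
    gains tend to 0, so all sums converge to the prescribed ones; since L is
    bounded below along the iteration, so is ln A on the support
    ([log_bounded]).

    When M has a positive diagonal and a symmetric support, W is obtained by
    putting v(i) v(j) / (sum of v) on the support of M and adding to the
    diagonal what is missing from the row sums ([symmetric_margins_witness]);
    this gives existence, uniqueness and convergence.

    If two scalings give the same S, the ratio of their left diagonals takes
    equal values at i and j whenever M(i,j) != 0, because the diagonal of M is
    in the support. A level set of this ratio is thus disconnected from its
    complement, so by full indecomposability the ratio is constant
    ([scaled_by_unique]). If moreover M is symmetric, S is symmetric by
    uniqueness, exchanging the two diagonals gives another scaling, and so they
    are proportional and can be balanced ([symmetric_scaling]). *)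

Set Implicit Arguments.
Unset Strict Implicit.
Unset Printing Implicit Defensive.

Import Order.TTheory GRing.Theory Num.Theory.
Import numFieldNormedType.Exports.

Local Open Scope classical_set_scope.
Local Open Scope ring_scope.

(** * Inequalities for the logarithm *)

(** A quadratic lower bound for one term of the generalized Kullback-Leibler
    divergence; the linear correction b - a is what makes a single term
    nonnegative. *)
Lemma kl_ge_sqr (R : realType) (s a b : R) :
  0 < a -> 0 < b -> a <= s -> b <= s ->
  (a - b) ^+ 2 <= 4 * s * (a * (ln a - ln b) - a + b).
Proof.
move=> a0 b0 les_a les_b.
(* ln x <= x - 1 is applied at x = q / p: the square roots make the resulting
   lower bound the perfect square (p - q)^2. *)
set p := Num.sqrt a; set q := Num.sqrt b.
have p0 : 0 < p by rewrite sqrtr_gt0.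
have q0 : 0 < q by rewrite sqrtr_gt0.
have pE : a = p ^+ 2 by rewrite sqr_sqrtr // ltW.
have qE : b = q ^+ 2 by rewrite sqr_sqrtr // ltW.
have ln_le : ln q - ln p <= q / p - 1.
  rewrite -ln_div ?posrE //.
  have := @le_ln1Dx R (q / p - 1); rewrite addrCA subrr addr0; apply.
  by have := divr_gt0 q0 p0; lra.
have kl : (p - q) ^+ 2 <= a * (ln a - ln b) - a + b.
  rewrite pE qE !lnXn // -!mulrnBl.
  have : p ^+ 2 * (ln q - ln p) <= p ^+ 2 * (q / p - 1).
    by rewrite ler_pM2l ?exprn_gt0.
  have -> : p ^+ 2 * (q / p - 1) = p * q - p ^+ 2.
    by field; rewrite gt_eqF.
  set lp := ln p; set lq := ln q; nra.
have pq_le : (p + q) ^+ 2 <= 4 * s.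
  have := sqr_ge0 (p - q); rewrite pE in les_a; rewrite qE in les_b; nra.
have -> : (a - b) ^+ 2 = (p + q) ^+ 2 * (p - q) ^+ 2 by rewrite pE qE; ring.
by apply: ler_pM => //; exact: sqr_ge0.
Qed.

(** Adding the previous bound for (a, b) and for (b, a) cancels the linear
    corrections. *)
Lemma ln_monotone_sqr (R : realType) (s a b : R) :
  0 < a -> 0 < b -> a <= s -> b <= s ->
  (a - b) ^+ 2 <= 2 * s * ((a - b) * (ln a - ln b)).
Proof.
move=> a0 b0 le_as le_bs.
have := kl_ge_sqr a0 b0 le_as le_bs; have := kl_ge_sqr b0 a0 le_bs le_as.
rewrite -(sqrrN (b - a)) opprB.
set la := ln a; set lb := ln b; lra.
Qed.

(** * Row sums, column sums and mass *)

Definition row_sum (R : realType) (m n : nat) (A : 'M[R]_(m, n)) i :=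
  \sum_j A i j.

Definition col_sum (R : realType) (m n : nat) (A : 'M[R]_(m, n)) j :=
  \sum_i A i j.

Definition mass (R : realType) (m n : nat) (A : 'M[R]_(m, n)) : R :=
  \sum_i row_sum A i.

Lemma row_sum_tr (R : realType) (m n : nat) (A : 'M[R]_(m, n)) :
  row_sum A^T = col_sum A.
Proof. by apply/funext => j; apply: eq_bigr => i _; rewrite mxE. Qed.

Lemma col_sum_tr (R : realType) (m n : nat) (A : 'M[R]_(m, n)) :
  col_sum A^T = row_sum A.
Proof. by rewrite -row_sum_tr trmxK. Qed.

Lemma mass_tr (R : realType) (m n : nat) (A : 'M[R]_(m, n)) :
  mass A^T = mass A.
Proof. by rewrite /mass row_sum_tr [RHS]exchange_big. Qed.

Lemma row_sumB (R : realType) (m n : nat) (A B : 'M[R]_(m, n)) i :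
  row_sum (A - B) i = row_sum A i - row_sum B i.
Proof. by rewrite /row_sum -sumrB; apply: eq_bigr => j _; rewrite !mxE. Qed.

Lemma col_sumB (R : realType) (m n : nat) (A B : 'M[R]_(m, n)) j :
  col_sum (A - B) j = col_sum A j - col_sum B j.
Proof. by rewrite /col_sum -sumrB; apply: eq_bigr => i _; rewrite !mxE. Qed.

Lemma entry_le_mass (R : realType) (m n : nat) (A : 'M[R]_(m, n)) i j :
  nonneg_mx A -> A i j <= mass A.
Proof.
move=> A0; rewrite /mass (bigD1 i) //= {1}/row_sum (bigD1 j) //= -addrA lerDl.
by rewrite addr_ge0 ?sumr_ge0 // => ? _; rewrite sumr_ge0.
Qed.

Lemma row_sum_gt0 (R : realType) (m n : nat) (W A : 'M[R]_(m, n)) i :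
  nonneg_mx A -> (forall j, W i j != 0 -> A i j != 0) -> 0 < row_sum W i ->
  0 < row_sum A i.
Proof.
move=> A0 WA; apply: contraTT; rewrite -!leNgt => A_le0.
rewrite /row_sum big1 // => j _; apply: contraTeq A_le0 => Wij.
rewrite -ltNge /row_sum (bigD1 j) //= ltr_pwDl ?sumr_ge0 //.
by rewrite lt_def WA // A0.
Qed.

Lemma sum_sqr_eq0 (R : realType) (m n : nat) (A : 'M[R]_(m, n)) :
  \sum_i \sum_j A i j ^+ 2 <= 0 -> A = 0.
Proof.
move=> le0; apply/matrixP => i j; rewrite mxE; apply/eqP.
rewrite -sqrf_eq0 eq_le sqr_ge0 andbT; apply: le_trans le0.
have B0 : nonneg_mx (\matrix_(i, j) A i j ^+ 2).
  by move=> a b; rewrite mxE sqr_ge0.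
have := entry_le_mass i j B0; rewrite mxE => /le_trans; apply.
by apply: ler_sum => a _; apply: ler_sum => b _; rewrite mxE.
Qed.

(** Summation by rows and by columns: a matrix of the form x(i) + y(j) sees D
    only through its row and column sums. *)
Lemma sum_mul_potentials (R : realType) (m n : nat) (D : 'M[R]_(m, n))
    (x : 'I_m -> R) (y : 'I_n -> R) :
  \sum_i \sum_j D i j * (x i + y j) =
  \sum_i row_sum D i * x i + \sum_j col_sum D j * y j.
Proof.
under eq_bigr do under eq_bigr do rewrite mulrDr.
under eq_bigr do rewrite big_split /= -mulr_suml.
rewrite big_split /= [X in _ + X]exchange_big /=; congr (_ + _).
by apply: eq_bigr => j _; rewrite mulr_suml.
Qed.

(** * Rescalings *)

Definition rescaling (R : realType) (m n : nat) (M A : 'M[R]_(m, n)) : Prop :=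
  exists (a : 'I_m -> R) (b : 'I_n -> R), [/\ forall i, 0 < a i,
    forall j, 0 < b j & forall i j, A i j = a i * M i j * b j].

Lemma rescaling_eq0 (R : realType) (m n : nat) (M A : 'M[R]_(m, n)) i j :
  rescaling M A -> (A i j == 0) = (M i j == 0).
Proof.
move=> [a [b [a0 b0 ->]]]; rewrite !mulf_eq0.
by rewrite (gt_eqF (a0 i)) (gt_eqF (b0 j)) orbF.
Qed.

Lemma rescaling_ge0 (R : realType) (m n : nat) (M A : 'M[R]_(m, n)) :
  nonneg_mx M -> rescaling M A -> nonneg_mx A.
Proof.
move=> M0 [a [b [a0 b0 AE]]] i j; rewrite AE.
by rewrite !mulr_ge0 // ltW.
Qed.

Lemma rescaling_euclidean (R : realType) (m n : nat) (M A B : 'M[R]_(m, n)) :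
  rescaling M A -> rescaling M B -> rescaling B A.
Proof.
move=> [a [b [a0 b0 AE]]] [a' [b' [a'0 b'0 BE]]].
exists (fun i => a i / a' i), (fun j => b j / b' j); split=> [i|j|i j].
- by rewrite divr_gt0.
- by rewrite divr_gt0.
- by rewrite AE BE; field; rewrite !gt_eqF.
Qed.

Lemma rescaling_tr (R : realType) (m n : nat) (M A : 'M[R]_(m, n)) :
  rescaling M A -> rescaling M^T A^T.
Proof.
move=> [a [b [a0 b0 AE]]]; exists b, a; split=> // i j.
by rewrite !mxE AE mulrC mulrA mulrAC.
Qed.

(** Off the support both logarithms are [ln 0], which is 0 by convention, so
    the log ratio vanishes there. *)
Definition log_ratio (R : realType) (m n : nat) (M A : 'M[R]_(m, n)) :
    'M[R]_(m, n) := \matrix_(i, j) (ln (A i j) - ln (M i j)).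

Lemma rescaling_log_ratio (R : realType) (m n : nat) (M A : 'M[R]_(m, n)) :
  nonneg_mx M -> rescaling M A -> exists (x : 'I_m -> R) (y : 'I_n -> R),
  forall i j, log_ratio M A i j = (x i + y j) *+ (M i j != 0).
Proof.
move=> M0 MA; have [a [b [a0 b0 AE]]] := MA.
exists (fun i => ln (a i)), (fun j => ln (b j)) => i j; rewrite mxE AE.
have [->|Mn0] := eqVneq (M i j) 0; first by rewrite mulr0 mul0r subrr.
have Mij : 0 < M i j by rewrite lt_def Mn0 M0.
by rewrite !lnM ?posrE ?mulr_gt0 //= mulr1n; ring.
Qed.

(** The identity behind both uniqueness and convergence: the pairing of A - M
    with ln A - ln M only depends on the row and column sums of A - M. *)
Lemma sum_rescaling_log (R : realType) (m n : nat) (M A : 'M[R]_(m, n))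
    (x : 'I_m -> R) (y : 'I_n -> R) : rescaling M A ->
  (forall i j, M i j != 0 -> log_ratio M A i j = x i + y j) ->
  \sum_i \sum_j (A i j - M i j) * log_ratio M A i j =
  \sum_i (row_sum A i - row_sum M i) * x i
  + \sum_j (col_sum A j - col_sum M j) * y j.
Proof.
move=> MA xyE; have := sum_mul_potentials (A - M) x y.
under [X in _ = X + _ -> _]eq_bigr do rewrite row_sumB.
under [X in _ = _ + X -> _]eq_bigr do rewrite col_sumB.
move=> <-; apply: eq_bigr => i _; apply: eq_bigr => j _.
rewrite [in RHS]mxE [in RHS]mxE.
have [M0|M0] := eqVneq (M i j) 0; last by rewrite xyE.
have /eqP A0 : A i j == 0 by rewrite (rescaling_eq0 _ _ MA) M0.
by rewrite A0 M0 subrr !mul0r.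
Qed.

Lemma sum_sqr_rescaling_le (R : realType) (m n : nat) (s : R)
    (M A : 'M[R]_(m, n)) : rescaling M A ->
  (forall i j, 0 <= M i j <= s) -> (forall i j, 0 <= A i j <= s) ->
  \sum_i \sum_j (A i j - M i j) ^+ 2 <=
  2 * s * \sum_i \sum_j (A i j - M i j) * log_ratio M A i j.
Proof.
move=> MA Ms As; rewrite mulr_sumr; apply: ler_sum => i _.
rewrite mulr_sumr; apply: ler_sum => j _; rewrite !mxE.
have /andP[A0 les_A] := As i j; have /andP[M0 les_M] := Ms i j.
have AM0 := rescaling_eq0 i j MA.
have [Mij|Mn0] := eqVneq (M i j) 0.
  have /eqP -> : A i j == 0 by rewrite AM0 Mij.
  by rewrite Mij !subrr mul0r expr0n mulr0.
by apply: ln_monotone_sqr; rewrite // lt_def ?A0 ?M0 ?AM0 ?Mn0.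
Qed.

(** When the row and column sums agree the pairing of A - M with ln A - ln M
    is 0, and it dominates the squared distance of A and M. *)
Lemma rescaling_unique (R : realType) (m n : nat) (M A : 'M[R]_(m, n)) :
  nonneg_mx M -> rescaling M A ->
  row_sum A =1 row_sum M -> col_sum A =1 col_sum M -> A = M.
Proof.
move=> M0 MA rAM cAM; have A0 := rescaling_ge0 M0 MA.
apply/eqP; rewrite -subr_eq0; apply/eqP/sum_sqr_eq0.
have [x [y xyE]] := rescaling_log_ratio M0 MA.
have := @sum_sqr_rescaling_le R m n (mass M) M A MA.
rewrite (sum_rescaling_log MA (x := x) (y := y)); last first.
  by move=> i j Mij; rewrite xyE Mij.
rewrite [X in _ * (X + _)]big1 => [|i _]; last by rewrite rAM subrr mul0r.
rewrite [X in _ * (_ + X)]big1 => [|i _]; last by rewrite cAM subrr mul0r.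
rewrite addr0 mulr0 => le0.
have -> : \sum_i \sum_j (A - M) i j ^+ 2 = \sum_i \sum_j (A i j - M i j) ^+ 2.
  by do 2![apply: eq_bigr => ? _]; rewrite !mxE.
apply: le0 => i j; rewrite ?M0 ?A0 /=; first exact: entry_le_mass.
by rewrite /mass -(eq_bigr _ (fun i _ => rAM i)); exact: entry_le_mass.
Qed.

(** * Potentials depending linearly on the log ratio *)

Section Potentials.
Variables (R : realType) (m n : nat) (E : 'I_m -> 'I_n -> bool).

Definition potential_mx (w : 'rV[R]_(m + n)) : 'M[R]_(m, n) :=
  \matrix_(i, j) ((w 0 (lshift n i) + w 0 (rshift m j)) *+ E i j).

Lemma potential_mx_is_linear : linear potential_mx.
Proof.
move=> a w w'; apply/matrixP => i j; rewrite !mxE.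
by case: (E i j); rewrite ?mulr1n ?mulr0n; ring.
Qed.

HB.instance Definition _ :=
  GRing.isLinear.Build R 'rV[R]_(m + n) 'M[R]_(m, n) *:%R potential_mx
    potential_mx_is_linear.

(** Potentials with u(i,j) = x(i) + y(j) on the support E are far from unique
    (one constant may be shifted per connected component of E), so those that
    come with u may be unbounded even if u is bounded. A linear right inverse of
    [potential_mx] selects potentials X(i).u and Y(j).u that are linear in u,
    hence bounded by u and convergent with u. *)
Lemma linear_potentials : exists (X : 'I_m -> 'M[R]_(m, n))
    (Y : 'I_n -> 'M[R]_(m, n)), forall (x : 'I_m -> R) (y : 'I_n -> R)
    (u : 'M[R]_(m, n)), (forall i j, u i j = (x i + y j) *+ E i j) ->
  forall i j, E i j -> u i j = \sum_a \sum_b u a b * X i a b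
                             + \sum_a \sum_b u a b * Y j a b.
Proof.
pose G := linfun potential_mx.
pose H a b := (G^-1)%VF (delta_mx a b).
have GinvE u k : (G^-1)%VF u 0 k = \sum_a \sum_b u a b * H a b 0 k.
  rewrite {1}[u]matrix_sum_delta linear_sum summxE; apply: eq_bigr => a _.
  rewrite linear_sum summxE; apply: eq_bigr => b _.
  by rewrite linearZ mxE.
exists (fun i => \matrix_(a, b) H a b 0 (lshift n i)),
       (fun j => \matrix_(a, b) H a b 0 (rshift m j)) => x y u uE i j Eij.
have uG : u \in limg G.
  apply/memv_imgP; exists (row_mx (\row_i x i) (\row_j y j)).
    exact: memvf.
  rewrite lfunE; apply/matrixP => a b.
  by rewrite uE /= !mxE (unsplitK (inl _)) (unsplitK (inr _)) !mxE.
rewrite -{1}(limg_lfunVK uG) lfunE /= mxE Eij mulr1n !GinvE.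
by congr (_ + _); do 2![apply: eq_bigr => ? _]; rewrite mxE.
Qed.
End Potentials.

(** * Sequences and limits *)

Lemma cvg_sumr (R : realType) (I : finType) (F : I -> nat -> R) (l : I -> R) :
  (forall i, F i k @[k --> \oo] --> l i) ->
  \sum_i F i k @[k --> \oo] --> \sum_i l i.
Proof. by move=> Fl; apply: cvg_big => //; exact: add_continuous. Qed.

Lemma cvg_sum_dist (R : realType) (I : finType) (f : I -> nat -> R)
    (l : I -> R) : (forall i, f i k @[k --> \oo] --> l i) ->
  \sum_i `|f i k - l i| @[k --> \oo] --> (0 : R).
Proof.
move=> fl; rewrite [X in _ --> X](_ : _ = \sum_i `|l i - l i|); last first.
  by rewrite big1 // => i _; rewrite subrr normr0.
apply: cvg_sumr => i; apply: cvg_norm.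
by apply: cvgB => //; exact: cvg_cst.
Qed.

Lemma cvg_mx_entries (R : realType) (m n : nat) (A : nat -> 'M[R]_(m, n))
    (S : 'M[R]_(m, n)) :
  (forall i j, A k i j @[k --> \oo] --> S i j) -> A @ \oo --> S.
Proof.
move=> AS; apply/cvg_ballP => e e0.
have near_entries : \forall k \near \oo, forall i j, `|S i j - A k i j| < e.
  apply: filter_forall => i; apply: filter_forall => j.
  by have /cvgrPdist_lt /(_ e e0) := AS i j.
near=> k; split=> // i j; rewrite -ball_normE /=.
by move: i j; near: k.
Unshelve. all: by end_near. Qed.

Lemma cauchy_sqr_cvg (R : realType) (a e : nat -> R) (C : R) :
  (forall k l, (a k - a l) ^+ 2 <= C * (e k + e l)) -> e @ \oo --> 0 ->
  cvgn a.
Proof.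
move=> le_sqr e0; apply/cauchy_cvgP/cauchy_ballP => d d0; near_simpl.
have Ce0 : (fun k => C * e k) @ \oo --> 0.
  by rewrite -[X in _ --> X](mulr0 C); apply: cvgM => //; exact: cvg_cst.
have d20 : 0 < d ^+ 2 / 2 by rewrite divr_gt0 ?exprn_gt0.
have near_e : \forall k \near \oo, C * e k < d ^+ 2 / 2.
  by apply: cvgr_lt Ce0 _ d20.
near=> k l => /=; rewrite -ball_normE /ball_ /=.
suff : `|a k - a l| ^+ 2 < d ^+ 2.
  by rewrite ltr_pXn2r ?nnegrE ?normr_ge0 ?(ltW d0).
rewrite real_normK ?num_real //.
apply: le_lt_trans (le_sqr k l) _; rewrite mulrDr [ltRHS]splitr.
by apply: ltrD; [near: k | near: l].
Unshelve. all: by end_near. Qed.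

Lemma cvg_sqr_dist (R : realType) (f g : nat -> R) (l C : R) :
  (forall k, (l - f k) ^+ 2 <= C * g k) -> g @ \oo --> 0 -> f @ \oo --> l.
Proof.
move=> le_sqr g0; apply/cvgrPdist_lt => e e0.
have Cg0 : (fun k => C * g k) @ \oo --> 0.
  by rewrite -[X in _ --> X](mulr0 C); apply: cvgM => //; exact: cvg_cst.
have near_g : \forall k \near \oo, C * g k < e ^+ 2.
  by apply: cvgr_lt Cg0 _ _; rewrite exprn_gt0.
near=> k; suff : `|l - f k| ^+ 2 < e ^+ 2.
  by rewrite ltr_pXn2r ?nnegrE ?normr_ge0 ?(ltW e0).
rewrite real_normK ?num_real //; apply: le_lt_trans (le_sqr k) _.
by near: k.
Unshelve. all: by end_near. Qed.

Lemma ler_norm_sum2 (R : realType) (m n : nat) (U X : 'M[R]_(m, n)) (C : R) :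
  (forall i j, `|U i j| <= C) ->
  `|\sum_i \sum_j U i j * X i j| <= C * \sum_i \sum_j `|X i j|.
Proof.
move=> UC; apply: le_trans (ler_norm_sum _ _ _) _; rewrite mulr_sumr.
apply: ler_sum => i _; apply: le_trans (ler_norm_sum _ _ _) _.
rewrite mulr_sumr.
by apply: ler_sum => j _; rewrite normrM ler_wpM2r.
Qed.

(** * Sequences of rescalings with converging sums *)

Section RescalingsCvg.
Variables (R : realType) (m n : nat) (M : 'M[R]_(m, n)).
Variables (A : nat -> 'M[R]_(m, n)) (r : 'I_m -> R) (c : 'I_n -> R) (C : R).
Hypothesis M0 : nonneg_mx M.
Hypothesis MA : forall k, rescaling M (A k).
Hypothesis lnA : forall k i j, `|ln (A k i j)| <= C.
Hypothesis rA : forall i, row_sum (A k) i @[k --> \oo] --> r i.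
Hypothesis cA : forall j, col_sum (A k) j @[k --> \oo] --> c j.

Let A0 k : nonneg_mx (A k). Proof. exact: rescaling_ge0 (MA k). Qed.

Let A_gt0 k i j : M i j != 0 -> 0 < A k i j.
Proof. by move=> M0ij; rewrite lt_def (rescaling_eq0 _ _ (MA k)) M0ij A0. Qed.

Lemma rescalings_le k i j : A k i j <= expR C.
Proof.
have [Aij|An0] := eqVneq (A k i j) 0; first by rewrite Aij expR_ge0.
have Aij : 0 < A k i j by rewrite lt_def An0 A0.
rewrite -[leLHS]lnK ?posrE // ler_expR.
exact: le_trans (ler_norm _) (lnA k i j).
Qed.

Lemma rescalings_ge k i j : M i j != 0 -> expR (- C) <= A k i j.
Proof.
move=> M0ij; rewrite -[leRHS]lnK ?posrE ?A_gt0 // ler_expR lerNl.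
by apply: le_trans (lnA k i j); rewrite -normrN ler_norm.
Qed.

(** The distance of two terms is controlled by how far their sums are from the
    limits r and c: in [sum_rescaling_log], the potentials chosen by
    [linear_potentials] are bounded uniformly in k and l. *)
Lemma rescalings_cauchy : exists K : R, forall k l i j,
  (A k i j - A l i j) ^+ 2 <=
  K * ((\sum_a `|row_sum (A k) a - r a| + \sum_b `|col_sum (A k) b - c b|)
     + (\sum_a `|row_sum (A l) a - r a| + \sum_b `|col_sum (A l) b - c b|)).
Proof.
have [X [Y XY]] := linear_potentials R (fun i j => M i j != 0).
pose x_bound := \sum_i \sum_a \sum_b `|X i a b|.
pose y_bound := \sum_j \sum_a \sum_b `|Y j a b|.
pose H := (C + C) * (x_bound + y_bound).
exists (2 * expR C * H) => k l i j.
have lk := rescaling_euclidean (MA k) (MA l).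
have [x0 [y0 xyE]] := rescaling_log_ratio (A0 l) lk.
set u := log_ratio (A l) (A k) in xyE.
have uC a b : `|u a b| <= C + C.
  rewrite mxE; apply: le_trans (ler_normB _ _) _.
  by apply: lerD; exact: lnA.
have C0 : 0 <= C + C by exact: le_trans (normr_ge0 _) (uC i j).
pose x a := \sum_a' \sum_b' u a' b' * X a a' b'.
pose y b := \sum_a' \sum_b' u a' b' * Y b a' b'.
have xb : 0 <= x_bound by do 3![apply: sumr_ge0 => ? _].
have yb : 0 <= y_bound by do 3![apply: sumr_ge0 => ? _].
have xH a : `|x a| <= H.
  apply: le_trans (ler_norm_sum2 _ uC) _; rewrite ler_wpM2l //.
  rewrite -[leLHS]addr0 lerD //.
  rewrite /x_bound [leRHS](bigD1 a) //= lerDl.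
  by do 3![apply: sumr_ge0 => ? _].
have yH b : `|y b| <= H.
  apply: le_trans (ler_norm_sum2 _ uC) _; rewrite ler_wpM2l //.
  rewrite -[leLHS]add0r lerD //.
  rewrite /y_bound [leRHS](bigD1 b) //= lerDl.
  by do 3![apply: sumr_ge0 => ? _].
have uxy a b : A l a b != 0 -> u a b = x a + y b.
  rewrite (rescaling_eq0 _ _ (MA l)) => Mab; apply: (XY x0 y0) => // a' b'.
  by rewrite xyE (rescaling_eq0 _ _ (MA l)).
have entry k' a b : 0 <= A k' a b <= expR C by rewrite A0 rescalings_le.
have := sum_sqr_rescaling_le lk (entry l) (entry k).
rewrite (sum_rescaling_log lk uxy) => sq_le.
have -> : (A k i j - A l i j) ^+ 2 =
  (\matrix_(a, b) (A k a b - A l a b) ^+ 2) i j by rewrite mxE.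
apply: (@le_trans _ _ (\sum_a \sum_b (A k a b - A l a b) ^+ 2)).
  apply: le_trans (@entry_le_mass _ _ _ _ i j _) _.
    by move=> a b; rewrite mxE sqr_ge0.
  by apply: ler_sum => a _; apply: ler_sum => b _; rewrite mxE.
apply: le_trans sq_le _; rewrite -[leRHS]mulrA ler_pM2l ?mulr_gt0 ?expR_gt0 //.
have dist_le (p q t z : R) :
    `|z| <= H -> (p - q) * z <= H * (`|p - t| + `|q - t|).
  move=> zH; apply: le_trans (ler_norm _) _; rewrite normrM mulrC.
  by apply: ler_pM => //; rewrite (distrC q); apply: ler_distD.
have -> (p q p' q' : R) :
    H * (p + q + (p' + q')) = H * (p + p') + H * (q + q').
  by ring.
rewrite -!big_split /= !mulr_sumr.
by apply: lerD; apply: ler_sum => ? _; exact: dist_le.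
Qed.

(** The limit S is positive on the support because the logarithms are bounded
    below. It is a rescaling since the selected potentials of A k are linear in
    the log ratio and therefore converge to potentials for S. *)
Lemma rescalings_cvg : exists S : 'M[R]_(m, n),
  [/\ rescaling M S, row_sum S =1 r, col_sum S =1 c & A @ \oo --> S].
Proof.
have [K cauchyA] := rescalings_cauchy.
have cvgA i j : cvgn (fun k => A k i j).
  apply: cauchy_sqr_cvg (fun k l => cauchyA k l i j) _.
  rewrite -[X in _ --> X](addr0 (0 : R)); apply: cvgD.
    exact: cvg_sum_dist rA.
  exact: cvg_sum_dist cA.
pose S : 'M[R]_(m, n) := \matrix_(i, j) limn (fun k => A k i j).
have AS i j : A k i j @[k --> \oo] --> S i j by rewrite mxE; exact: cvgA.
exists S; split.
- have [X [Y XY]] := linear_potentials R (fun i j => M i j != 0).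
  have A_eq0 k i j : M i j = 0 -> A k i j = 0.
    by move=> Mij; apply/eqP; rewrite (rescaling_eq0 _ _ (MA k)) Mij.
  have S_eq0 i j : M i j = 0 -> S i j = 0.
    move=> Mij; apply: cvg_unique (AS i j) _ => //=.
    by under eq_cvg do rewrite A_eq0 //; exact: cvg_cst.
  have S0 i j : M i j != 0 -> 0 < S i j.
    move=> Mij; apply: lt_le_trans (expR_gt0 (- C)) _.
    by apply: cvgr_to_ge (AS i j) _; apply: nearW => k; exact: rescalings_ge.
  have uS i j : log_ratio M (A k) i j @[k --> \oo] --> log_ratio M S i j.
    rewrite mxE; under eq_cvg do rewrite mxE.
    apply: cvgB; last exact: cvg_cst.
    have [Mij|Mij] := eqVneq (M i j) 0.
      by rewrite S_eq0 //; under eq_cvg do rewrite A_eq0 //; exact: cvg_cst.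
    by apply: continuous_cvg (AS i j); apply: continuous_ln; exact: S0.
  pose pot (Z : 'M[R]_(m, n)) := \sum_a \sum_b log_ratio M S a b * Z a b.
  exists (fun i => expR (pot (X i))), (fun j => expR (pot (Y j))).
  split=> [i|j|i j]; rewrite ?expR_gt0 //.
  have [Mij|Mij] := eqVneq (M i j) 0.
    by rewrite Mij mulr0 mul0r S_eq0.
  have lnS : ln (S i j) - ln (M i j) = pot (X i) + pot (Y j).
    have := uS i j; rewrite [log_ratio M S i j]mxE => lim1.
    apply: cvg_unique lim1 _ => //=.
    have uE k : log_ratio M (A k) i j =
        \sum_a \sum_b log_ratio M (A k) a b * X i a b
        + \sum_a \sum_b log_ratio M (A k) a b * Y j a b.
      have [x [y xyE]] := rescaling_log_ratio M0 (MA k).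
      exact: (XY x y).
    under eq_cvg do rewrite uE.
    by apply: cvgD; apply: cvg_sumr => a; apply: cvg_sumr => b;
      apply: cvgM => //; exact: cvg_cst.
  have Mij0 : 0 < M i j by rewrite lt_def Mij M0.
  rewrite -[LHS]lnK ?posrE ?S0 // -[X in _ * X * _]lnK ?posrE //.
  rewrite -!expRD; congr expR.
  by rewrite -addrA addrCA -lnS addrC subrK.
- move=> i; have lim_r : row_sum (A k) i @[k --> \oo] --> row_sum S i.
    by apply: cvg_sumr.
  exact: (@cvg_unique _ (@Rhausdorff R) _ _ _ _ lim_r (@rA i)).
- move=> j; have lim_c : col_sum (A k) j @[k --> \oo] --> col_sum S j.
    by apply: cvg_sumr.
  exact: (@cvg_unique _ (@Rhausdorff R) _ _ _ _ lim_c (@cA j)).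
- exact: cvg_mx_entries.
Qed.
End RescalingsCvg.

(** * Normalization of rows and columns *)

Definition normalize_rows (R : realType) (m n : nat) (r : 'I_m -> R)
    (A : 'M[R]_(m, n)) : 'M[R]_(m, n) :=
  \matrix_(i, j) (r i / row_sum A i * A i j).

Definition normalize_cols (R : realType) (m n : nat) (c : 'I_n -> R)
    (A : 'M[R]_(m, n)) : 'M[R]_(m, n) :=
  (normalize_rows c A^T)^T.

Lemma row_sum_normalize (R : realType) (m n : nat) (r : 'I_m -> R)
    (A : 'M[R]_(m, n)) i :
  row_sum A i != 0 -> row_sum (normalize_rows r A) i = r i.
Proof.
move=> A0; rewrite {1}/row_sum; under eq_bigr do rewrite mxE.
by rewrite -mulr_sumr -/(row_sum A i) divfK.
Qed.

Lemma rescaling_normalize_rows (R : realType) (m n : nat) (r : 'I_m -> R)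
    (M A : 'M[R]_(m, n)) : (forall i, 0 < r i) -> (forall i, 0 < row_sum A i) ->
  rescaling M A -> rescaling M (normalize_rows r A).
Proof.
move=> r0 A0 [a [b [a0 b0 AE]]].
exists (fun i => r i / row_sum A i * a i), b; split=> // [i|i j].
  by rewrite mulr_gt0 // divr_gt0.
by rewrite mxE [in A i j]AE; ring.
Qed.

(** For A of given mass this is, up to a constant, the opposite of the
    Kullback-Leibler divergence of W from A; it is the Lyapunov function of the
    iteration. *)
Definition log_likelihood (R : realType) (m n : nat) (W A : 'M[R]_(m, n)) : R :=
  \sum_i \sum_j W i j * ln (A i j).

Lemma log_likelihood_tr (R : realType) (m n : nat) (W A : 'M[R]_(m, n)) :
  log_likelihood W^T A^T = log_likelihood W A.
Proof.
rewrite /log_likelihood [RHS]exchange_big.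
by do 2![apply: eq_bigr => ? _]; rewrite !mxE.
Qed.

(** Since W has row sums r, rescaling row i by r(i) / R(i) adds
    r(i) (ln r(i) - ln R(i)) to the log-likelihood. As W and A have the same
    mass, the corrections R(i) - r(i) sum to 0, and the gain is a sum of
    divergence terms bounded below by [kl_ge_sqr]. *)
Lemma normalize_rows_gain (R : realType) (m n : nat) (r : 'I_m -> R)
    (W A : 'M[R]_(m, n)) :
  nonneg_mx A -> (forall i, 0 < row_sum A i) -> (forall i, 0 < r i) ->
  (forall i j, W i j != 0 -> A i j != 0) -> row_sum W =1 r ->
  mass W = mass A ->
  let gain := log_likelihood W (normalize_rows r A) - log_likelihood W A in
  0 <= gain /\ forall i, (r i - row_sum A i) ^+ 2 <= 4 * mass A * gain.
Proof.
move=> A_ge0 A0 r0 WA rW tot gain.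
pose kl i := r i * (ln (r i) - ln (row_sum A i)) - r i + row_sum A i.
have gainE : gain = \sum_i kl i.
  rewrite /kl big_split sumrB /= -(eq_bigr _ (fun i _ => rW i)) -/(mass W) tot.
  rewrite -/(mass A) subrK /gain /log_likelihood -sumrB.
  apply: eq_bigr => i _; rewrite -sumrB -[in RHS]rW mulr_suml.
  apply: eq_bigr => j _; rewrite mxE -mulrBr.
  have [->|Wij] := eqVneq (W i j) 0; first by rewrite !mul0r.
  have Aij : 0 < A i j by rewrite lt_def WA // A_ge0.
  by rewrite lnM ?ln_div ?posrE ?divr_gt0 // addrK rW.
have le_tot i : row_sum A i <= mass A.
  rewrite /mass (bigD1 i) //= lerDl; apply: sumr_ge0 => ? _; exact: ltW.
have le_tot' i : r i <= mass A.
  rewrite -tot /mass (eq_bigr _ (fun i _ => rW i)) (bigD1 i) //= lerDl.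
  by apply: sumr_ge0 => ? _; exact: ltW.
have kl_ge i : (r i - row_sum A i) ^+ 2 <= 4 * mass A * kl i.
  exact: kl_ge_sqr.
have tot0 (i : 'I_m) : 0 < 4 * mass A.
  by rewrite mulr_gt0 ?ltr0n //; apply: lt_le_trans (le_tot i); exact: A0.
have kl0 i : 0 <= kl i.
  rewrite -(pmulr_rge0 _ (tot0 i)); exact: le_trans (sqr_ge0 _) (kl_ge i).
split=> [|i]; first by rewrite gainE sumr_ge0.
apply: le_trans (kl_ge i) _; rewrite ler_pM2l ?(tot0 i) // gainE.
rewrite (bigD1 i) //= lerDl.
exact: sumr_ge0.
Qed.

Lemma ln_entry_le_mass (R : realType) (m n : nat) (A : 'M[R]_(m, n)) i j :
  nonneg_mx A -> ln (A i j) <= mass A.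
Proof.
move=> A0; apply: le_trans (entry_le_mass i j A0).
have [->|An0] := eqVneq (A i j) 0; first by rewrite ln0.
by apply/ltW/ln_sublinear; rewrite lt_def An0 A0.
Qed.

Lemma log_likelihood_le (R : realType) (m n : nat) (W A : 'M[R]_(m, n)) :
  nonneg_mx W -> nonneg_mx A ->
  log_likelihood W A <= mass W * mass A.
Proof.
move=> W0 A0; rewrite mulr_suml; apply: ler_sum => i _.
rewrite mulr_suml; apply: ler_sum => j _; apply: ler_wpM2l => //.
exact: ln_entry_le_mass.
Qed.

(** Every term W(a,b) (mass A - ln A(a,b)) is nonnegative and their sum is
    mass W * mass A minus the log-likelihood, so a lower bound on the latter
    bounds each ln A(i,j) from below where W(i,j) is positive. *)
Lemma log_bounded (R : realType) (m n : nat) (W A : 'M[R]_(m, n)) (L : R) :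
  nonneg_mx W -> nonneg_mx A -> (forall i j, A i j != 0 -> W i j != 0) ->
  L <= log_likelihood W A ->
  forall i j, `|ln (A i j)| <=
    mass A + \sum_a \sum_b `|mass W * mass A - L| / W a b.
Proof.
move=> W0 A0 AW LA i j; set t := mass A.
have le_t a b : ln (A a b) <= t by exact: ln_entry_le_mass.
have t0 : 0 <= t by exact: le_trans (A0 i j) (entry_le_mass i j A0).
set d := `|_ - L|; set B := \sum_a \sum_b d / W a b.
have dW a b : 0 <= d / W a b by rewrite divr_ge0 // normr_ge0.
have dWB : d / W i j <= B.
  have V0 : nonneg_mx (\matrix_(a, b) (d / W a b)) by move=> a b; rewrite mxE.
  have := entry_le_mass i j V0; rewrite mxE => /le_trans; apply.
  by apply: ler_sum => a _; apply: ler_sum => b _; rewrite mxE.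
have B0 : 0 <= B by exact: le_trans dWB.
have [->|An0] := eqVneq (A i j) 0; first by rewrite ln0 // normr0 addr_ge0.
have Wij : 0 < W i j by rewrite lt_def AW // W0.
have gap : t - ln (A i j) <= d / W i j.
  rewrite ler_pdivlMr // mulrC.
  pose V := \matrix_(a, b) (W a b * (t - ln (A a b))).
  have V0 : nonneg_mx V by move=> a b; rewrite mxE mulr_ge0 // subr_ge0.
  have := entry_le_mass i j V0; rewrite [V i j]mxE => /le_trans; apply.
  apply: le_trans (ler_norm _).
  have -> : mass V = mass W * t - log_likelihood W A.
    rewrite mulr_suml -sumrB; apply: eq_bigr => a _.
    rewrite mulr_suml -sumrB; apply: eq_bigr => b _.
    by rewrite mxE mulrBr.
  by rewrite lerB.
rewrite ler_norml; have := le_t i j; set l := ln _ in gap *.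
by move=> lt; apply/andP; split; lra.
Qed.

(** * Convergence of the iteration *)

Lemma sk_mx_row_step (R : realType) (n : nat) (r : 'cV[R]_n)
    (s : sinkhorn_state R n) :
  sk_mx (row_step r s) = normalize_rows (fun i => r i 0) (sk_mx s).
Proof. by apply/matrixP => i j; rewrite /= mul_diag_mx !mxE. Qed.

Lemma sk_mx_col_step (R : realType) (n : nat) (c : 'cV[R]_n)
    (s : sinkhorn_state R n) :
  sk_mx (col_step c s) = normalize_cols (fun j => c j 0) (sk_mx s).
Proof.
apply/matrixP => i j; rewrite /= mul_mx_diag !mxE row_sum_tr.
exact: mulrC.
Qed.

Section Sinkhorn.
Variables (R : realType) (n : nat) (M W : 'M[R]_n) (r c : 'cV[R]_n).
Hypothesis M_ge0 : nonneg_mx M.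
Hypothesis r_gt0 : forall i, 0 < r i 0.
Hypothesis c_gt0 : forall j, 0 < c j 0.
Hypothesis W_ge0 : nonneg_mx W.
Hypothesis W_supp : forall i j, (W i j == 0) = (M i j == 0).
Hypothesis W_row : forall i, row_sum W i = r i 0.
Hypothesis W_col : forall j, col_sum W j = c j 0.

Let A k := sk_mx (sinkhorn M r c k).
Let rf i := r i 0.
Let cf j := c j 0.

Lemma row_sum_rescaling_gt0 (B : 'M[R]_n) i : rescaling M B -> 0 < row_sum B i.
Proof.
move=> MB; apply: (@row_sum_gt0 _ _ _ W); rewrite ?W_row //.
  exact: rescaling_ge0 MB.
by move=> j; rewrite W_supp (rescaling_eq0 _ _ MB).
Qed.

Lemma col_sum_rescaling_gt0 (B : 'M[R]_n) j : rescaling M B -> 0 < col_sum B j.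
Proof.
move=> MB; rewrite -row_sum_tr.
apply: (@row_sum_gt0 _ _ _ W^T); rewrite ?row_sum_tr ?W_col //.
  by move=> a b; rewrite mxE; exact: rescaling_ge0 MB _ _.
by move=> i; rewrite !mxE W_supp (rescaling_eq0 _ _ MB).
Qed.

Lemma sinkhornS k : A k.+1 =
  if odd k then normalize_cols cf (A k) else normalize_rows rf (A k).
Proof.
by rewrite /A /=; case: odd; rewrite ?sk_mx_row_step ?sk_mx_col_step.
Qed.

Lemma rescaling_sinkhorn k : rescaling M (A k).
Proof.
elim: k => [|k MA].
  by exists (fun=> 1), (fun=> 1); split=> // i j; rewrite mul1r mulr1.
rewrite sinkhornS; case: odd; last first.
  by apply: rescaling_normalize_rows => // i; exact: row_sum_rescaling_gt0.
rewrite -[M]trmxK; apply/rescaling_tr/rescaling_normalize_rows => //.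
  by move=> j; rewrite row_sum_tr; exact: col_sum_rescaling_gt0.
exact: rescaling_tr.
Qed.

Lemma sinkhorn_ge0 k : nonneg_mx (A k).
Proof. exact: rescaling_ge0 (rescaling_sinkhorn k). Qed.

Lemma row_sum_sinkhorn k i : ~~ odd k -> row_sum (A k.+1) i = rf i.
Proof.
move=> ok; rewrite sinkhornS (negPf ok) row_sum_normalize // gt_eqF //.
exact/row_sum_rescaling_gt0/rescaling_sinkhorn.
Qed.

Lemma col_sum_sinkhorn k j : odd k -> col_sum (A k.+1) j = cf j.
Proof.
move=> ok; rewrite sinkhornS ok -row_sum_tr trmxK row_sum_normalize //.
rewrite row_sum_tr gt_eqF //.
exact/col_sum_rescaling_gt0/rescaling_sinkhorn.
Qed.

(** This starts at the first step: the initial M may have any mass. *)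
Lemma mass_sinkhorn k : mass (A k.+1) = mass W.
Proof.
case ok: (odd k); last first.
  by apply: eq_bigr => i _; rewrite W_row row_sum_sinkhorn ?ok.
rewrite -mass_tr -[RHS]mass_tr; apply: eq_bigr => j _.
by rewrite !row_sum_tr W_col col_sum_sinkhorn.
Qed.

(** After each half-step one of the two families of sums is exact and the next
    half-step corrects the other one, so a single gain controls both errors. *)
Lemma sinkhorn_gain k :
  let gain := log_likelihood W (A k.+2) - log_likelihood W (A k.+1) in
  [/\ 0 <= gain,
      forall i, (r i 0 - row_sum (A k.+1) i) ^+ 2 <= 4 * mass W * gain &
      forall j, (c j 0 - col_sum (A k.+1) j) ^+ 2 <= 4 * mass W * gain].
Proof.
have MA := rescaling_sinkhorn k.+1; have A0 := sinkhorn_ge0 k.+1.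
have WA i j : W i j != 0 -> A k.+1 i j != 0.
  by rewrite W_supp (rescaling_eq0 _ _ MA).
have tot := mass_sinkhorn k.
have W0 : 0 <= mass W by do 2![apply: sumr_ge0 => ? _].
rewrite (sinkhornS k.+1) /=; case ok: (odd k) => /=.
  have row0 i : 0 < row_sum (A k.+1) i by exact: row_sum_rescaling_gt0.
  have [gain0 gainE] :=
    @normalize_rows_gain _ _ _ rf W _ A0 row0 r_gt0 WA W_row (esym tot).
  rewrite tot in gainE.
  split=> // j; rewrite col_sum_sinkhorn // subrr expr0n.
  by rewrite mulr_ge0 // mulr_ge0.
have col0 j : 0 < row_sum (A k.+1)^T j.
  by rewrite row_sum_tr; exact: col_sum_rescaling_gt0.
have A0T : nonneg_mx (A k.+1)^T by move=> i j; rewrite mxE.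
have WAT i j : W^T i j != 0 -> (A k.+1)^T i j != 0 by rewrite !mxE; exact: WA.
have WT : row_sum W^T =1 cf by move=> j; rewrite row_sum_tr.
have totT : mass W^T = mass (A k.+1)^T by rewrite !mass_tr.
have := @normalize_rows_gain _ _ _ cf W^T _ A0T col0 c_gt0 WAT WT totT.
rewrite -(log_likelihood_tr W) log_likelihood_tr mass_tr tot row_sum_tr.
rewrite -[normalize_rows _ _]trmxK log_likelihood_tr.
move=> [gain0 gainE]; split=> // i.
by rewrite row_sum_sinkhorn ?ok // subrr expr0n mulr_ge0 // mulr_ge0.
Qed.

(** The log-likelihood is nondecreasing and bounded, so the gains tend to 0 and
    with them the errors of the sums; being at least its first value, it also
    bounds the logarithms. This is what [rescalings_cvg] asks for. *)
Theorem sinkhorn_cvg : exists S : 'M[R]_n,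
  [/\ rescaling M S, forall i, row_sum S i = r i 0,
      forall j, col_sum S j = c j 0 & A @ \oo --> S].
Proof.
pose L k := log_likelihood W (A k.+1).
have L_nd : nondecreasing_seq L.
  apply/nondecreasing_seqP => k; have [gain0 _ _] := sinkhorn_gain k.
  by rewrite -subr_ge0.
have cvgL : cvgn L.
  apply: nondecreasing_is_cvgn => //; exists (mass W * mass W) => _ [k _ <-].
  rewrite -[X in _ <= _ * X](mass_sinkhorn k).
  exact/log_likelihood_le/sinkhorn_ge0.
have gain0 : (fun k => L k.+1 - L k) @ \oo --> 0.
  rewrite -[X in _ --> X](subrr (limn L)); apply: cvgB => //.
  by rewrite (cvg_shiftS L).
have supp_A k i j : A k i j != 0 -> W i j != 0.
  by rewrite W_supp (rescaling_eq0 _ _ (rescaling_sinkhorn k)).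
have := @rescalings_cvg R n n M (fun k => A k.+1) rf cf
  (mass W + \sum_a \sum_b `|mass W * mass W - L 0%N| / W a b) M_ge0.
case.
- by move=> k; exact: rescaling_sinkhorn.
- move=> k i j; rewrite -{1 3}(mass_sinkhorn k).
  apply: log_bounded => //; [exact: sinkhorn_ge0 | exact: supp_A |].
  exact: L_nd.
- move=> i; apply: cvg_sqr_dist gain0 => k.
  by have [_ + _] := sinkhorn_gain k; apply.
- move=> j; apply: cvg_sqr_dist gain0 => k.
  by have [_ _] := sinkhorn_gain k; apply.
move=> S [MS rS cS AS]; exists S; split=> //.
by rewrite -(cvg_shiftS A).
Qed.
End Sinkhorn.

(** * Diagonal matrices and prescribed sums *)

Lemma diag_sandwich (R : realType) (n : nat) (A Dl Dr : 'M[R]_n) i j :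
  is_diag_mx Dl -> is_diag_mx Dr ->
  (Dl *m A *m Dr) i j = Dl i i * A i j * Dr j j.
Proof.
move=> /is_diag_mxP Dl0 /is_diag_mxP Dr0; rewrite mxE (bigD1 j) //=.
rewrite big1 ?addr0 => [|k kj]; last by rewrite (Dr0 k j) ?mulr0.
rewrite mxE (bigD1 i) //= big1 ?addr0 // => k ki.
by rewrite (Dl0 i k) ?mul0r // eq_sym.
Qed.

Lemma rescaling_scaled_by (R : realType) (n : nat) (M S : 'M[R]_n) :
  rescaling M S <-> exists Dl Dr, scaled_by M S Dl Dr.
Proof.
split=> [[a [b [a0 b0 SE]]]|[Dl [Dr [[Dld Dl0] [Drd Dr0] ->]]]].
  exists (diag_mx (\row_i a i)), (diag_mx (\row_j b j)); split.
  - by split=> [|i]; rewrite ?diag_mx_is_diag // !mxE eqxx mulr1n.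
  - by split=> [|i]; rewrite ?diag_mx_is_diag // !mxE eqxx mulr1n.
  - by apply/matrixP => i j; rewrite mul_mx_diag mxE mul_diag_mx !mxE SE.
exists (fun i => Dl i i), (fun j => Dr j j); split=> // i j.
exact: diag_sandwich.
Qed.

Lemma scaled_with_sumsP (R : realType) (n : nat) (M S : 'M[R]_n)
    (r c : 'cV[R]_n) : scaled_with_sums M r c S <->
  [/\ rescaling M S, forall i, row_sum S i = r i 0 &
      forall j, col_sum S j = c j 0].
Proof.
have rowE i : (S *m ones n) i 0 = row_sum S i.
  by rewrite mxE; apply: eq_bigr => j _; rewrite mxE mulr1.
have colE j : ((ones n)^T *m S) 0 j = col_sum S j.
  by rewrite mxE; apply: eq_bigr => i _; rewrite !mxE mul1r.
split=> [[/rescaling_scaled_by MS Sr Sc]|[/rescaling_scaled_by MS Sr Sc]].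
  by split=> // [i|j]; rewrite -?rowE -?colE ?Sr // Sc mxE.
split=> //; first by apply/colP => i; rewrite rowE.
by apply/rowP => j; rewrite colE Sc mxE.
Qed.

(** The matrix v v^T / (sum of v) has row and column sums v. Restricting it to
    the support of M lowers the row sums, and since the diagonal is in the
    support the deficit can be put there. Symmetry of the support makes the
    result symmetric, so its column sums are right as well. *)
Lemma symmetric_margins_witness (R : realType) (n : nat) (M : 'M[R]_n)
    (v : 'cV[R]_n) :
  (forall i, M i i != 0) -> (forall i j, (M i j == 0) = (M j i == 0)) ->
  (forall i, 0 < v i 0) ->
  exists W : 'M[R]_n, [/\ nonneg_mx W, forall i j, (W i j == 0) = (M i j == 0),
    forall i, row_sum W i = v i 0 & forall j, col_sum W j = v j 0].
Proof.
move=> Md Ms v0; pose s := \sum_i v i 0.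
pose T i j := (v i 0 * v j 0 / s) *+ (M i j != 0).
pose g i := v i 0 - \sum_j T i j.
have s0 (i : 'I_n) : 0 < s.
  by rewrite /s (bigD1 i) //= ltr_pwDl // sumr_ge0 // => j _; exact: ltW.
have T0 i j : 0 <= T i j.
  by rewrite mulrn_wge0 // divr_ge0 ?mulr_ge0 // ltW ?(s0 i).
(* A row of T sums to at most v i, its value when M has full support. *)
have g0 i : 0 <= g i.
  rewrite subr_ge0; apply: (@le_trans _ _ (\sum_j v i 0 * v j 0 / s)).
    apply: ler_sum => j _; rewrite /T.
    case: (_ != _); rewrite ?mulr1n ?mulr0n //.
    by rewrite divr_ge0 ?mulr_ge0 // ltW ?(s0 i).
  by rewrite -mulr_suml -mulr_sumr mulfK // gt_eqF ?(s0 i).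
have Tsym i j : T i j = T j i by rewrite /T Ms [v i 0 * _]mulrC.
pose W : 'M[R]_n := \matrix_(i, j) (T i j + g i *+ (i == j)).
have Wsym i j : W i j = W j i.
  by rewrite !mxE Tsym eq_sym; case: eqP => [->|].
have Wrow i : row_sum W i = v i 0.
  rewrite /row_sum; under eq_bigr do rewrite mxE.
  rewrite big_split /= [X in _ + X](bigD1 i) //= eqxx mulr1n.
  rewrite [X in _ + (_ + X)]big1 ?addr0 => [|j]; last first.
    by rewrite eq_sym => /negPf ->.
  by rewrite addrC subrK.
exists W; split=> // [i j|i j|j].
- by rewrite mxE addr_ge0 // mulrn_wge0.
- rewrite mxE paddr_eq0 ?T0 ?mulrn_wge0 //; have [Mij|Mij] := eqVneq (M i j) 0.
    rewrite /T Mij eqxx mulr0n eqxx /=; have [ij|_] := eqVneq i j.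
      by move: Mij; rewrite ij => /eqP; rewrite (negPf (Md j)).
    by rewrite mulr0n eqxx.
  by rewrite /T Mij mulr1n gt_eqF // divr_gt0 ?mulr_gt0 // (s0 i).
- by rewrite -(Wrow j) /col_sum /row_sum; apply: eq_bigr => i _; exact: Wsym.
Qed.

(** * Full indecomposability and uniqueness of the diagonals *)

Lemma perm_front (n : nat) (I : {set 'I_n}) :
  exists s : {perm 'I_n}, forall k, (s k \in I) = (k < #|I|)%N.
Proof.
pose e := enum I ++ enum (~: I)%SET.
have size_e : size e = n.
  by rewrite size_cat -!cardE cardsC card_ord.
have uniq_e : uniq e.
  rewrite cat_uniq !enum_uniq andbT /=; apply/hasPn => x.
  by rewrite !mem_enum inE.
pose f (k : 'I_n) := nth k e k.
have f_inj : injective f.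
  move=> j k; rewrite /f (set_nth_default k) ?size_e // => /eqP.
  by rewrite nth_uniq ?size_e // => /eqP/val_inj.
exists (perm f_inj) => k; rewrite permE /f nth_cat -cardE.
have [lt_k|ge_k] := ltnP k #|I|.
  by rewrite -mem_enum mem_nth // -cardE.
have : nth k (enum (~: I)%SET) (k - #|I|) \in enum (~: I)%SET.
  rewrite mem_nth // -(ltn_add2l #|I|) subnKC //.
  by rewrite [X in (X + _)%N]cardE -size_cat size_e.
by rewrite mem_enum inE => /negPf ->.
Qed.

(** Listing I first, on rows and columns alike, exhibits a proper nonempty I as
    a forbidden block decomposition. *)
Lemma fully_indecomposable_closed (R : realType) (n : nat) (A : 'M[R]_n)
    (I : {set 'I_n}) : fully_indecomposable A ->
  (forall i j, i \notin I -> j \in I -> A i j = 0) -> (0 < #|I|)%N ->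
  I = [set: 'I_n]%SET.
Proof.
move=> A_indec A0 I0; apply: contrapT => IT; apply: A_indec.
have [s sI] := perm_front I.
have ltI : (#|I| < n)%N.
  rewrite -[X in (_ < X)%N](card_ord n) -cardsT proper_card // properT.
  exact/eqP.
pose B := row_perm s (col_perm s A).
have E : (#|I| + (n - #|I|))%N = n by rewrite subnKC // ltnW.
have B0 (i j : 'I_n) : (#|I| <= i)%N -> (j < #|I|)%N -> B i j = 0.
  by move=> Ii Ij; rewrite !mxE A0 // sI // -leqNgt.
exists #|I|, (n - #|I|)%N, E, (perm_mx s), (perm_mx s^-1).
have [A11 [A12 [A22 BE]]] : exists A11 A12 A22,
    B = castmx (E, E) (block_mx A11 A12 0 A22).
  move: (#|I|) (n - #|I|)%N E B B0 => p q E; case: _ / E => B B0.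
  exists (ulsubmx B), (ursubmx B), (drsubmx B); rewrite castmx_id.
  rewrite -[LHS]submxK; congr block_mx; apply/matrixP => i j.
  by rewrite !mxE B0 //= leq_addr.
exists A11, A12, A22; split=> //.
- by rewrite subn_gt0.
- exact: perm_mx_is_perm.
- exact: perm_mx_is_perm.
- by rewrite -BE /B row_permE col_permE mulmxA.
Qed.

(** For two scalings of M with the same result, the ratio a of the left
    diagonals and the ratio of the right ones are inverse to each other at
    (i, j) in the support. Evaluating at (j, j) shows a(i) = a(j), so the level
    sets of a are as in [fully_indecomposable_closed]. *)
Lemma scaled_by_unique (R : realType) (n : nat) (M S Dl Dr : 'M[R]_n) :
  (forall i, M i i != 0) -> fully_indecomposable M -> scaled_by M S Dl Dr ->
  forall Dl' Dr', scaled_by M S Dl' Dr' <->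
    exists2 t : R, 0 < t & Dl' = t^-1 *: Dl /\ Dr' = t *: Dr.
Proof.
move=> Md M_indec [[Dld Dl0] [Drd Dr0] SE] Dl' Dr'; split; last first.
  move=> [t t0 [-> ->]]; split.
  - split=> [|i]; last by rewrite mxE mulr_gt0 ?invr_gt0.
    by apply/is_diag_mxP => i j ij; rewrite mxE (is_diag_mxP Dld) ?mulr0.
  - split=> [|i]; last by rewrite mxE mulr_gt0.
    by apply/is_diag_mxP => i j ij; rewrite mxE (is_diag_mxP Drd) ?mulr0.
  - by rewrite -!scalemxAl -scalemxAr scalerA mulVf ?scale1r // gt_eqF.
move=> [[Dld' Dl0'] [Drd' Dr0'] SE'].
pose a i := Dl i i / Dl' i i.
have ratio i j : M i j != 0 -> Dr' j j = a i * Dr j j.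
  move=> Mij; have : (Dl *m M *m Dr) i j = (Dl' *m M *m Dr') i j.
    by rewrite -SE -SE'.
  rewrite !diag_sandwich // => eqS; apply: (mulfI (lt0r_neq0 (Dl0' i))).
  apply: (mulfI Mij); rewrite /a mulrCA mulrA -eqS.
  by field; exact: lt0r_neq0.
have a_closed i j : M i j != 0 -> a i = a j.
  move=> Mij; apply: (mulIf (lt0r_neq0 (Dr0 j))).
  by rewrite -ratio // -ratio.
have [t t0 a_t] : exists2 t, 0 < t & forall i, a i = t.
  have [i0 _|n0] := pickP (fun _ : 'I_n => true); last first.
    by exists 1 => // i; have := n0 i.
  exists (a i0); first by rewrite divr_gt0.
  have IT : [set i | a i == a i0]%SET = [set: 'I_n]%SET.
    apply: fully_indecomposable_closed M_indec _ _ => [i j|]; last first.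
      by apply/card_gt0P; exists i0; rewrite inE.
    rewrite !inE => ai /eqP aj; apply/eqP; apply: contraNT ai => Mij.
    by rewrite (a_closed _ _ Mij) aj.
  by move=> i; move/finset.setP/(_ i): IT; rewrite !inE => /eqP.
exists t => //; split; apply/matrixP => i j; rewrite mxE.
  have [<-|ij] := eqVneq i j; last first.
    by rewrite (is_diag_mxP Dld) ?(is_diag_mxP Dld') ?mulr0.
  rewrite -(a_t i) /a; field; rewrite !lt0r_neq0 //.
have [<-|ij] := eqVneq i j; last first.
  by rewrite (is_diag_mxP Drd) ?(is_diag_mxP Drd') ?mulr0.
by rewrite -(a_t i) -ratio.
Qed.

(** Transposing exchanges the two diagonals, so Dr = Dl / t for some t, and
    Dl / sqrt t may be used on both sides. Uniqueness: two such D are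
    proportional by both u and 1 / u, and u > 0 forces u = 1. *)
Lemma symmetric_scaling (R : realType) (n : nat) (M S : 'M[R]_n) :
  (forall i, M i i != 0) -> fully_indecomposable M -> M = M^T -> S = S^T ->
  rescaling M S -> exists! D, pos_diag_mx D /\ S = D *m M *m D.
Proof.
move=> Md M_indec MT ST /rescaling_scaled_by[Dl [Dr Slr]].
have uniq := scaled_by_unique Md M_indec.
have [[Dld Dl0] [Drd Dr0] SE] := Slr.
have diag_tr (D : 'M[R]_n) : is_diag_mx D -> D^T = D.
  move=> /is_diag_mxP Dd; apply/matrixP => i j; rewrite mxE.
  by have [->//|ij] := eqVneq i j; rewrite !Dd // eq_sym.
have Srl : scaled_by M S Dr Dl.
  split=> //; rewrite ST SE !trmx_mul -MT mulmxA.
  by rewrite (diag_tr _ Dld) (diag_tr _ Drd).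
have [t t0 [DrE _]] := (uniq _ _ _ Slr _ _).1 Srl.
have st0 : 0 < Num.sqrt t by rewrite sqrtr_gt0.
pose D := (Num.sqrt t)^-1 *: Dl.
have Dpos : pos_diag_mx D.
  split=> [|i]; last by rewrite mxE mulr_gt0 ?invr_gt0.
  by apply/is_diag_mxP => i j ij; rewrite mxE (is_diag_mxP Dld) ?mulr0.
have SD : S = D *m M *m D.
  rewrite SE DrE /D -!scalemxAl -!scalemxAr scalerA -invfM -expr2.
  by rewrite sqr_sqrtr // ltW.
exists D; split=> // D' [D'pos SD'].
have [u u0 [D'V D'E]] :=
  (uniq _ _ _ (And3 Dpos Dpos SD) _ _).1 (And3 D'pos D'pos SD').
apply/matrixP => i j; suff u1 : u = 1 by rewrite D'E u1 scale1r.
have uV : u^-1 = u.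
  apply: (mulIf (lt0r_neq0 (Dpos.2 i))).
  have : (u^-1 *: D) i i = (u *: D) i i by rewrite -D'V -D'E.
  by rewrite [LHS]mxE [RHS]mxE.
have u2 : u ^+ 2 = 1 by rewrite expr2 -{1}uV mulVf ?lt0r_neq0.
by apply/eqP; rewrite -(@eqrXn2 _ 2) ?ltW // u2 expr1n.
Qed.

(** * Scaling to prescribed equal row and column sums *)

Theorem theorem3p10 (R : realType) (n : nat) (M : 'M[R]_n) (v : 'cV[R]_n)
    (M_ge0 : nonneg_mx M)
    (M_diag : forall i : 'I_n, (i, i) \in supp M)
    (M_supp : supp M = supp M^T)
    (v_gt0 : forall i : 'I_n, 0 < v i 0) :
  exists S : 'M[R]_n,
    [/\ scaled_with_sums M v v S,
        (forall S' : 'M[R]_n, scaled_with_sums M v v S' -> S' = S),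
        (fun k : nat => sk_mx (sinkhorn M v v k)) @ \oo --> S &
        fully_indecomposable M ->
          (forall Dl Dr : 'M[R]_n, scaled_by M S Dl Dr ->
             forall Dl' Dr' : 'M[R]_n,
               scaled_by M S Dl' Dr' <->
               exists2 t : R, 0 < t & Dl' = t^-1 *: Dl /\ Dr' = t *: Dr) /\
          (M = M^T ->
             exists! D : 'M[R]_n, pos_diag_mx D /\ S = D *m M *m D)].
Proof.
have Md i : M i i != 0 by have := M_diag i; rewrite inE.
have Ms i j : (M i j == 0) = (M j i == 0).
  have := congr1 (fun E : {set _} => (i, j) \in E) M_supp.
  by rewrite !inE mxE /=; do 2!case: eqP.
have [W [W0 WM Wr Wc]] := symmetric_margins_witness Md Ms v_gt0.
have [S [MS Sr Sc AS]] := sinkhorn_cvg M_ge0 v_gt0 v_gt0 W0 WM Wr Wc.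
have S_uniq S' : rescaling M S' -> (forall i, row_sum S' i = v i 0) ->
    (forall j, col_sum S' j = v j 0) -> S' = S.
  move=> MS' Sr' Sc'; apply: rescaling_unique.
  - exact: rescaling_ge0 MS.
  - exact: rescaling_euclidean MS' MS.
  - by move=> i; rewrite Sr Sr'.
  - by move=> j; rewrite Sc Sc'.
exists S; split=> //; first exact/scaled_with_sumsP.
  by move=> S' /scaled_with_sumsP[]; exact: S_uniq.
move=> M_indec; split=> [Dl Dr|MT]; first exact: scaled_by_unique.
apply: symmetric_scaling => //; apply: esym; apply: S_uniq.
- by rewrite MT; exact: rescaling_tr.
- by move=> i; rewrite row_sum_tr.
- by move=> j; rewrite col_sum_tr.
Qed.
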